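(* Let $\alpha>0$. The space $BV_\alpha(\mathbb{R}^d)$ embeds compactly into $L^1(\mathbb{R}^d)$: every sequence $(g_n)$ with $\sup_n\|g_n\|_{BV_\alpha}<\infty$ has a subsequence converging in $L^1(\mathbb{R}^d)$.
   Context: Let $\rho_\alpha(x)=(1+|x|^2)^{\alpha/2}$ and $L^1_\alpha(\mathbb{R}^d)$ the space of measurable $f$ with $\|f\|_{L^1_\alpha}:=\int\rho_\alpha|f|\,dx<\infty$. Let $\psi$ be a Radon probability measure on $\mathbb{R}^d$ absolutely continuous with respect to Lebesgue measure, with a continuous bounded density $\psi'$ satisfying $\psi'>0$ everywhere. For Borel $S$, $\operatorname{osc}(f,S):=\operatorname{ess\,sup}_S f-\operatorname{ess\,inf}_S f$ (essential with respect to Lebesgue measure). Define $\|f\|_{BV_\alpha}:=\|f\|_{L^1_\alpha}+\sup_{\epsilon\in(0,1]}\epsilon^{-1}\int_{\mathbb{R}^d}\operatorname{osc}(f,B_\epsilon(x))\,d\psi(x)$, and $BV_\alpha(\mathbb{R}^d)$ is the space of $f\in L^1_\alpha$ with finite $BV_\alpha$ norm. *)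

(* Defs.v *)
From HB Require Import structures.
From mathcomp Require Import all_boot all_order all_algebra.
From mathcomp Require Import all_classical all_reals all_analysis.
Set Implicit Arguments. Unset Strict Implicit. Unset Printing Implicit Defensive.
Import Order.TTheory GRing.Theory Num.Theory.
Local Open Scope classical_set_scope.
Local Open Scope ring_scope.

(* R^d is modelled as d.-tuple R with the product (= Borel) sigma-algebra
   provided by MathComp-Analysis. *)
Section Defs.
Variables (R : realType) (d : nat).
Notation Rd := (d.-tuple R).

Definition sqnorm (x : Rd) : R := \sum_(i < d) (tnth x i) ^+ 2.

Definition edist (x y : Rd) : R :=
  Num.sqrt (\sum_(i < d) (tnth x i - tnth y i) ^+ 2).

Definition eball (x : Rd) (eps : R) : set Rd := [set y | edist x y < eps].

Definition econtinuous (f : Rd -> R) : Prop :=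
  forall x (e : R), 0 < e -> exists2 del : R, 0 < del &
    forall y, edist x y < del -> `|f y - f x| < e.

Definition rho (alpha : R) (x : Rd) : R := powR (1 + sqnorm x) (alpha / 2).

(* mu is Lebesgue measure on R^d: the measure of every half-open box is the
   product of its side lengths (this determines it uniquely on Borel sets) *)
Definition is_lebesgue (mu : {measure set Rd -> \bar R}) : Prop :=
  forall a b : Rd, (forall i, tnth a i <= tnth b i) ->
    mu [set x | forall i, tnth a i < tnth x i <= tnth b i]
    = (\prod_(i < d) (tnth b i - tnth a i))%:E.

Definition ess_sup_on (mu : {measure set Rd -> \bar R}) (S : set Rd)
  (f : Rd -> R) : \bar R :=
  ereal_inf [set y | \forall x \ae mu, S x -> ((f x)%:E <= y)%E].
Definition ess_inf_on (mu : {measure set Rd -> \bar R}) (S : set Rd)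
  (f : Rd -> R) : \bar R :=
  ereal_sup [set y | \forall x \ae mu, S x -> (y <= (f x)%:E)%E].

Definition osc (mu : {measure set Rd -> \bar R}) (S : set Rd) (f : Rd -> R) : \bar R := (ess_sup_on mu S f - ess_inf_on mu S f)%E.

Definition L1norm_w (mu : {measure set Rd -> \bar R}) (alpha : R) (f : Rd -> R) : \bar R :=
  (\int[mu]_x ((rho alpha x * `|f x|)%:E))%E.

Definition BVnorm (mu : {measure set Rd -> \bar R}) (psi : {measure set Rd -> \bar R}) (alpha : R)
  (f : Rd -> R) : \bar R :=
  (L1norm_w mu alpha f +
   ereal_sup [set (eps^-1)%:E * \int[psi]_x osc mu (eball x eps) f
             | eps in [set e : R | (0 < e <= 1)%R]])%E.

End Defs.

(* Main.v *)
Require Import Defs.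
From HB Require Import structures.
From mathcomp Require Import all_boot all_order all_algebra.
From mathcomp Require Import all_classical all_reals all_analysis.
From mathcomp Require Import measurable_realfun ring lra.
Import Order.TTheory GRing.Theory Num.Theory.
Import numFieldNormedType.Exports.
Local Open Scope classical_set_scope.
Local Open Scope ring_scope.

(* Cut a cube ]-m, m]^d into cells so small that a cell lies in the eps-ball
   around each of its points.  Then osc(f, cell) <= osc(f, B_eps(x)) for x in
   the cell, and since psi' is bounded below by some c > 0 on the cube,
     sum over cells of osc(f, cell) * |cell| <= (eps / c) * ||f||_BV.
   Hence f is within O(eps) in L^1 of the step function equal to ess inf f on
   each cell.  The countably many sequences ess inf (g_n, cell), over all cells
   of all grids, are bounded, so a single subsequence makes all of them
   converge.  Outside the cube the weight rho_alpha is large, so the L^1 mass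
   there is uniformly small, and the subsequence is Cauchy in L^1. *)

(** * Monotonicity of the integral and extraction of a subsequence *)

(* The integral of a nonnegative function is a supremum over simple functions,
   so it is monotone without measurability; this spares us the measurability of
   [x |-> osc (eball x eps) f]. *)
Lemma ge0_le_integral_nonmeasurable d (T : measurableType d) (R : realType)
    (mu : {measure set T -> \bar R}) (D : set T) (f1 f2 : T -> \bar R) :
  (forall x, D x -> (0 <= f1 x)%E) ->
  (forall x, D x -> (f1 x <= f2 x)%E) ->
  (\int[mu]_(x in D) f1 x <= \int[mu]_(x in D) f2 x)%E.
Proof.
move=> f10 f12; rewrite !ge0_integralE//; last first.
  by move=> x Dx; apply: le_trans (f12 x Dx); exact: f10.
apply: ereal_sup_le => _ [h /= hf <-]; exists h => // x.
apply: (le_trans (hf x)); exact: lee_restrict.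
Qed.

(* By Tychonoff the sequence [n |-> u ^~ n] has a cluster point [p] in the
   product; [W e k] constrains only the coordinates of code below [k]. *)
Lemma bounded_family_cvg_subseq (R : realType) (I : countType)
    (u : I -> nat -> R) :
  (forall i, exists M, forall n, `|u i n| <= M) ->
  exists phi : nat -> nat, {homo phi : m n / (m < n)%N} /\
    forall i, cvgn (u i \o phi).
Proof.
move=> /choice[M uM].
pose K := prod_topology (fun _ : I => R^o).
pose U : nat -> K := fun n i => u i n.
have cA : compact [set f : K | forall i, [set` `[- M i, M i]] (f i)].
  apply: (@tychonoff I (fun _ => R^o) (fun i => [set` `[- M i, M i]])) => i.
  exact: segment_compact.
have [|p [Ap clp]] := cA (U @ \oo) _.
  by exists 0%N => // n _ i /=; rewrite in_itv/= -ler_norml uM.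
pose W e k : set K :=
  [set f | forall i, (pickle i < k)%N -> `|f i - p i| < e].
have nbW e k : 0 < e -> nbhs p (W e k).
  (* [pickle] is injective, so passing from [k] to [k.+1] constrains at most one further coordinate,
     which is an open condition in the product topology. *)
  move=> e0; elim: k => [|k ih]; first by apply: filterE => f i.
  have : nbhs p [set f : K | forall i, pickle i = k -> `|f i - p i| < e].
    have [[i ik]|Ni] := pselect (exists i : I, pickle i = k); last first.
      by apply: filterE => f i ik; exfalso; apply: Ni; exists i.
    have pV : nbhs p [set f : K | ball (p i) e (f i)].
      exact: (@proj_continuous I (fun _ => R^o) i p (ball (p i) e)
        (nbhsx_ballx _ _ e0)).
    apply: (@filterS K (nbhs p) _ _ _ _ pV) => f /= fi j jk.
    have -> : j = i by apply: (pcan_inj pickleK); rewrite jk ik.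
    by rewrite distrC.
  move=> nbk; apply: (@filterS2 K (nbhs p) _ _ _ _ _ ih nbk) => f fW fk i.
  rewrite ltnS leq_eqVlt => /orP[/eqP|].
    exact: fk.
  exact: fW.
(* Every neighbourhood of the cluster point meets every tail of [U]; choosing each index beyond the
   previous one gives a strictly increasing [phi]. *)
have next k N : {n | (N < n)%N /\ W (k.+1%:R^-1) k (U n)}.
  apply: cid.
  have /(_ [set U n | n in [set n | (N < n)%N]]
    (W (k.+1%:R^-1) k)) := clp.
  case => [||f [[n Nn <-] Wf]].
  - by exists N.+1 => // n Nn; exists n.
  - exact: nbW.
  - by exists n.
pose fix phi k := match k with
  | 0%N => sval (next 0%N 0%N) | k'.+1 => sval (next k (phi k')) end.
have phiS k : (phi k < phi k.+1)%N by rewrite /=; case: (next _ _) => n [].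
have phiW k : W (k.+1%:R^-1) k (U (phi k)).
  by case: k => [|k] /=; case: (next _ _) => n [].
exists phi; split; first exact: (homo_ltn ltn_trans).
move=> i; apply/cvg_ex; exists (p i).
apply/cvgrPdist_lt => e e0; near=> k.
rewrite distrC /=; apply: lt_le_trans (phiW k i _) _.
  by near: k; exists (pickle i).+1.
near: k; near=> k; apply: ltW; near: k.
exact: near_infty_natSinv_lt (PosNum e0).
Unshelve. all: by end_near. Qed.

(** * Completeness of L^1 *)

Lemma cvge0_ge0P (R : realType) (u : nat -> \bar R) :
  (forall n, 0 <= u n)%E ->
  (forall e : R, 0 < e -> exists N, forall n, (N <= n)%N -> (u n <= e%:E)%E) ->
  u @ \oo --> 0%E.
Proof.
move=> u0 ue; apply/fine_cvgP; split.
  have [N uN] := ue 1 ltr01; exists N => // n /= Nn.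
  by rewrite ge0_fin_numE//; apply: le_lt_trans (uN _ Nn) (ltry _).
apply/cvgrPdist_le => e e0; have [N uN] := ue _ e0; exists N => // n /= Nn.
rewrite sub0r normrN ger0_norm ?fine_ge0//.
rewrite -lee_fin fineK ?uN// ge0_fin_numE//.
exact: le_lt_trans (uN _ Nn) (ltry _).
Qed.

Lemma limn_einf_ge0 (R : realType) (u : nat -> \bar R) :
  (forall n, 0 <= u n)%E -> (0 <= limn_einf u)%E.
Proof.
move=> u0; rewrite limn_einf_lim; apply: lime_ge; first exact: is_cvg_einfs.
apply: nearW => j; apply: le_ereal_inf_tmp => _ [k _ <-]; exact: u0.
Qed.

Lemma measurable_limn_einf d (T : measurableType d) (R : realType)
    (w : nat -> T -> \bar R) : (forall n, measurable_fun setT (w n)) ->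
  measurable_fun setT (fun x => limn_einf (w ^~ x)).
Proof.
move=> mw; have -> : (fun x => limn_einf (w ^~ x)) =
    (fun x => - limn_esup (-%E \o w ^~ x))%E.
  by apply/funext => x; rewrite limn_esupN oppeK.
apply: measurableT_comp => //; apply: measurable_fun_limn_esup => n.
exact: measurableT_comp.
Qed.

(** Riesz-Fischer argument: along a subsequence [v] with geometrically small gaps, the sum of
    [|v j.+1 - v j|] has finite integral, hence is finite almost everywhere, so [v] converges almost
    everywhere. Fatou's lemma turns the Cauchy bounds into bounds on the distance to the limit. *)
Lemma L1_complete d (T : measurableType d) (R : realType)
    (mu : {measure set T -> \bar R}) (f : nat -> T -> R) :
  (forall n, mu.-integrable setT (EFin \o f n)) ->
  (forall e : R, 0 < e -> exists N, forall m n, (N <= m)%N -> (N <= n)%N ->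
    (\int[mu]_x (`|f m x - f n x|)%:E <= e%:E)%E) ->
  exists h : T -> R, [/\ measurable_fun setT h,
    mu.-integrable setT (EFin \o h) &
    (fun n => (\int[mu]_x (`|f n x - h x|)%:E)%E) @ \oo --> 0%E].
Proof.
move=> intf cau.
have mf n : measurable_fun setT (f n).
  by apply/measurable_EFinP; exact: (measurable_int mu).
have mdist (g k : T -> R) : measurable_fun setT g -> measurable_fun setT k ->
    measurable_fun setT (fun x => (`|g x - k x|)%:E).
  move=> mg mk; apply/measurable_EFinP; apply: measurableT_comp => //.
  exact: measurable_funB.
have half0 j : 0 < 1 / (2 ^ (j + 1))%:R :> R.
  by rewrite divr_gt0// ltr0n expn_gt0.
have [K KP] := choice (fun j => cau _ (half0 j)).
(* The running maximum puts both [v j] and [v j.+1] beyond [K j], so their distance is at most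
   [1 / 2 ^ (j + 1)]. *)
pose K' j := (\max_(i < j.+1) K i)%N.
have KK' i j : (i <= j)%N -> (K i <= K' j)%N.
  move=> ij; have ij' : (i < j.+1)%N by [].
  exact: (leq_bigmax (Ordinal ij')).
pose v j := f (K' j).
have Gfin : (\int[mu]_x (\sum_(0 <= j <oo) (`|v j.+1 x - v j x|)%:E) < +oo)%E.
  rewrite integral_nneseries//; last by move=> n; apply: mdist; exact: mf.
  apply: (@le_lt_trans _ _ (\sum_(0 <= j <oo) (1 / (2 ^ (j + 1))%:R)%:E)%E).
    apply: lee_nneseries => [j _ _|j _].
      by apply: integral_ge0 => x _; rewrite lee_fin.
    by apply: KP; apply: KK'.
  have /cvg_lim -> // := @cvg_geometric_eseries_half R 1 0.
  exact: ltry.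
have mG : measurable_fun setT
    (fun x => \sum_(0 <= j <oo) (`|v j.+1 x - v j x|)%:E)%E.
  apply: ge0_emeasurable_sum => [k x _ _|k _]; first by rewrite lee_fin.
  by apply: mdist; exact: mf.
have aev : \forall x \ae mu, cvgn (v ^~ x).
  have : mu.-integrable setT
      (fun x => \sum_(0 <= j <oo) (`|v j.+1 x - v j x|)%:E)%E.
    apply/integrableP; split; first exact: mG.
    apply: le_lt_trans Gfin; apply: ge0_le_integral_nonmeasurable => x _ //.
    by rewrite gee0_abs// nneseries_ge0.
  move=> /(integrable_ae measurableT); apply: filterS => x /(_ I) Gx.
  have {Gx} cs : cvgn (series (telescope (v ^~ x))).
    apply: normed_cvg; apply: nnseries_is_cvg => [i|]; first exact: normr_ge0.
    by move: Gx; rewrite fin_numE ltey => /andP[].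
  have -> : v ^~ x = (fun n => v 0%N x + series (telescope (v ^~ x)) n).
    by apply/funext => n; rewrite -eq_sum_telescope.
  by apply: is_cvgD => //; exact: is_cvg_cst.
(* The upper limit is defined and measurable on the whole space, and equals the limit wherever [v]
   converges. *)
pose h x := fine (limn_esup (fun j => (v j x)%:E)).
have mh : measurable_fun setT h.
  apply: measurableT_comp => //.
  apply: measurable_fun_limn_esup => n.
  by apply/measurable_EFinP; exact: mf.
have aeh : \forall x \ae mu, v ^~ x @ \oo --> h x.
  apply: filterS aev => x /cvg_ex[/= l vl].
  suff -> : h x = l by [].
  rewrite /h (cvg_limn_einf_sup (l := l%:E) _).2//.
  by apply: cvg_EFin => //; exact: nearW.
have tail i n : (K i <= n)%N ->
    (\int[mu]_x (`|f n x - h x|)%:E <= (1 / (2 ^ (i + 1))%:R)%:E)%E.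
  (* The shift by [i] puts every [v (j + i)] beyond [K i], so Fatou's lemma applies with the bound
     for [i]. *)
  move=> Kin; pose w j x := (`|f n x - v (j + i)%N x|)%:E.
  have mw j : measurable_fun setT (w j) by apply: mdist; exact: mf.
  have -> : (\int[mu]_x (`|f n x - h x|)%:E =
             \int[mu]_x limn_einf (w ^~ x))%E.
    apply: ge0_ae_eq_integral => //.
    - by apply: mdist => //; exact: mf.
    - exact: measurable_limn_einf.
    - by move=> x _; apply: limn_einf_ge0 => j; rewrite lee_fin.
    apply: filterS aeh => x vx _; apply/esym.
    have wx : w ^~ x @ \oo --> (`|f n x - h x|)%:E.
      apply: cvg_EFin; first exact: nearW.
      rewrite /comp /=; apply: cvg_norm; apply: cvgB; first exact: cvg_cst.
      by rewrite (cvg_shiftn i (v ^~ x)).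
    by rewrite (cvg_limn_einf_sup wx).1.
  apply: le_trans (fatou _ measurableT mw _) _.
    by move=> j x _; rewrite lee_fin.
  rewrite limn_einf_lim; apply: lime_le; first exact: is_cvg_einfs.
  apply: nearW => j; apply: ereal_inf_le.
  exists (\int[mu]_x w j x)%E; first by exists j => /=.
  by apply: KP => //; apply: KK'; rewrite leq_addl.
have tail_fin n : (K 0 <= n)%N -> (\int[mu]_x (`|f n x - h x|)%:E < +oo)%E.
  by move=> /(tail 0%N) /le_lt_trans; apply; exact: ltry.
exists h; split => //.
- apply/integrableP; split; first exact/measurable_EFinP.
  (* [h] is integrable because [|h| <= |f (K 0)| + |f (K 0) - h|]. *)
  have /integrableP[_ fK] := intf (K 0%N).
  apply: le_lt_trans (lte_add_pinfty fK (tail_fin _ (leqnn _))).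
  rewrite -ge0_integralD//; last 2 first.
  - by apply: measurableT_comp => //; apply/measurable_EFinP; exact: mf.
  - by apply: mdist => //; exact: mf.
  apply: ge0_le_integral => //.
  - by apply: measurableT_comp => //; exact/measurable_EFinP.
  - apply: emeasurable_funD; last by apply: mdist => //; exact: mf.
    by apply: measurableT_comp => //; apply/measurable_EFinP; exact: mf.
  move=> x _ /=; rewrite -EFinD lee_fin -lerBlDl.
  by rewrite distrC; exact: lerB_dist.
- apply: cvge0_ge0P => [n|e e0].
    by apply: integral_ge0 => x _; rewrite lee_fin.
  have [k _ /(_ k (leqnn k)) /= ke] := near_infty_natSinv_lt (PosNum e0).
  exists (K k) => n /tail /le_trans; apply; rewrite lee_fin.
  apply: le_trans (ltW ke); rewrite div1r lef_pV2 ?posrE ?ltr0n ?expn_gt0//.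
  by rewrite ler_nat addn1 ltnW// ltn_expl.
Qed.

(** * Essential oscillation *)

Section EssentialOscillation.
Variables (R : realType) (d : nat) (mu : {measure set (d.-tuple R) -> \bar R}).
Implicit Types (S : set (d.-tuple R)) (f : d.-tuple R -> R).

(** The infimum runs over a possibly uncountable set of almost everywhere bounds, but it is the
    limit of a sequence of them, and countably many null sets have a null union. *)
Lemma ess_sup_on_ge S f :
  \forall x \ae mu, S x -> ((f x)%:E <= ess_sup_on mu S f)%E.
Proof.
rewrite /ess_sup_on; set A := (X in ereal_inf X).
have [u uA uinf] : {u : nat -> \bar R | forall i, A (u i) &
    u @ \oo --> ereal_inf A}.
  apply: ereal_inf_seq; apply/set0P; exists +oo%E.
  by apply: nearW => x _; rewrite leey.
have := ae_foralln uA; apply: filterS => x fu Sx.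
rewrite -(cvg_lim _ uinf)//; apply: lime_ge; first by apply/cvgP: uinf.
by apply: nearW => n; exact: fu.
Qed.

Lemma ess_inf_on_le S f :
  \forall x \ae mu, S x -> (ess_inf_on mu S f <= (f x)%:E)%E.
Proof.
rewrite /ess_inf_on; set A := (X in ereal_sup X).
have [u uA usup] : {u : nat -> \bar R | forall i, A (u i) &
    u @ \oo --> ereal_sup A}.
  apply: ereal_sup_seq; apply/set0P; exists -oo%E.
  by apply: nearW => x _; rewrite leNye.
have := ae_foralln uA; apply: filterS => x fu Sx.
rewrite -(cvg_lim _ usup)//; apply: lime_le; first by apply/cvgP: usup.
by apply: nearW => n; exact: fu.
Qed.

Lemma ae_ess_bounds S f : \forall x \ae mu, S x ->
  (ess_inf_on mu S f <= (f x)%:E)%E /\ ((f x)%:E <= ess_sup_on mu S f)%E.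
Proof.
have := ess_sup_on_ge S f; have := ess_inf_on_le S f.
by apply: filterS2 => x xI xS Sx; split; [exact: xI|exact: xS].
Qed.

Lemma ae_ex_of_not_negligible S (P : d.-tuple R -> Prop) :
  ~ mu.-negligible S -> (\forall x \ae mu, S x -> P x) ->
  exists2 x, S x & P x.
Proof.
move=> nS aeP; apply: contrapT => nex; apply: nS.
apply: (negligibleS _ aeP) => x Sx /= SP; apply: nex.
by exists x => //; exact: SP.
Qed.

Lemma le_osc S S' f : S `<=` S' -> (osc mu S f <= osc mu S' f)%E.
Proof.
move=> SS'; apply: leeB.
  by apply: ereal_inf_le_tmp => y; apply: filterS => x fy /SS'; exact: fy.
by apply: ereal_sup_le => y; apply: filterS => x fy /SS'; exact: fy.
Qed.

(** On a negligible set the oscillation is [-oo - +oo = -oo]; a non-negligible set contains a point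
    whose value lies between the two essential bounds. *)
Lemma osc_ge0 S f : ~ mu.-negligible S -> (0 <= osc mu S f)%E.
Proof.
move=> nS.
have [x Sx [xI xS]] := ae_ex_of_not_negligible S _ nS (ae_ess_bounds S f).
by have := leeB xS xI; rewrite subee.
Qed.

(** The point [x] excludes an essential infimum [+oo] and an essential supremum [-oo]; finiteness of
    the difference excludes the other infinite values, so [fine] loses nothing. *)
Lemma ae_osc_bounds S f : ~ mu.-negligible S -> (osc mu S f < +oo)%E ->
  let v := fine (ess_inf_on mu S f) in
  \forall x \ae mu, S x -> v <= f x <= v + fine (osc mu S f).
Proof.
move=> nS oy v.
have [x Sx [xI xS]] := ae_ex_of_not_negligible S _ nS (ae_ess_bounds S f).
apply: filterS (ae_ess_bounds S f) => y + Sy; move=> /(_ Sy) [].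
move: oy xI xS; rewrite /v /osc.
case: (ess_inf_on mu S f) => [i||]; case: (ess_sup_on mu S f) => [s||] //=.
by rewrite !lee_fin => _ _ _ -> /=; lra.
Qed.

End EssentialOscillation.

(** * Grids of cells *)

Section Grid.
Variables (R : realType) (d : nat).
Notation Rd := (d.-tuple R).

(** Half-open as in [is_lebesgue], which gives its measure, and so that adjacent boxes are
    disjoint. *)
Definition box (a b : Rd) : set Rd :=
  [set x | forall i, tnth a i < tnth x i <= tnth b i].

Lemma measurable_box (a b : Rd) : measurable (box a b).
Proof.
have -> : box a b = \bigcap_(i in [set: 'I_d])
    ((fun x : Rd => tnth x i) @^-1` `]tnth a i, tnth b i]).
  apply/seteqP; split=> [x abx i _|x abx i] /=; first by rewrite in_itv/= abx.
  by have := abx i I; rewrite /= in_itv.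
apply: fin_bigcap_measurable; first exact: finite_finset.
move=> i _; rewrite -[X in measurable X]setTI.
exact: measurable_tnth.
Qed.

(* [edist] unqualified is the extended distance of MathComp-Analysis. *)
Lemma lt_edist (x y : Rd) (s : R) : 0 < s ->
  (forall i, `|tnth x i - tnth y i| <= s) -> Defs.edist x y < d.+1%:R * s.
Proof.
move=> s0 xys; have ds0 : 0 < d.+1%:R * s by rewrite mulr_gt0.
rewrite /Defs.edist -(ltr_pXn2r (n := 2)) ?nnegrE ?sqrtr_ge0 ?(ltW ds0)//.
rewrite sqr_sqrtr; last by apply: sumr_ge0 => i _; exact: sqr_ge0.
(* The squared distance is at most [d * s ^+ 2], and [d < d.+1 ^ 2] is strict even for [d = 0]. *)
apply: (@le_lt_trans _ _ (\sum_(i < d) s ^+ 2)).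
  apply: ler_sum => i _; rewrite -[leLHS]real_normK ?num_real//.
  by rewrite ler_pXn2r ?nnegrE// ltW.
rewrite sumr_const card_ord -[ltLHS]mulr_natl exprMn ltr_pM2r ?exprn_gt0//.
by rewrite -natrX ltr_nat (@leq_trans (d.+1 ^ 1))// leq_pexp2l.
Qed.

(* The shift by [d] makes the radius [d.+1 * mesh N] at most [1], as required
   in the BV seminorm. *)
Definition mesh (N : nat) : R := (N + d).+1%:R^-1.

Lemma mesh_gt0 N : 0 < mesh N.
Proof. by rewrite invr_gt0 ltr0n. Qed.

(** In each coordinate, []-m, m]] is cut into [m * 2 * (N + d).+1] intervals of length [mesh N]; [j]
    picks one interval per coordinate. *)
Definition cell m N (j : {ffun 'I_d -> 'I_(m * 2 * (N + d).+1)}) : set Rd :=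
  box [tuple (j i)%:R * mesh N - m%:R | i < d]
      [tuple (j i).+1%:R * mesh N - m%:R | i < d].

Lemma cellE m N j x : cell m N j x <->
  forall i, (j i)%:R * mesh N - m%:R < tnth x i <= (j i).+1%:R * mesh N - m%:R.
Proof. by split=> jx i; have := jx i; rewrite !tnth_mktuple. Qed.

Lemma trivIset_cell m N : trivIset setT (cell m N).
Proof.
apply/trivIsetP => j k _ _ /eqP jk; apply/seteqP; split=> // x [].
rewrite !cellE => jx kx; apply: jk; apply/ffunP => i; apply/val_inj => /=.
have {jx} /andP[jl jr] := jx i; have {kx} /andP[kl kr] := kx i.
have le1 (a b : nat) : a%:R * mesh N - m%:R < tnth x i ->
    tnth x i <= b.+1%:R * mesh N - m%:R -> (a <= b)%N.
  move=> ax bx; have := lt_le_trans ax bx.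
  by rewrite ltrD2r ltr_pM2r ?mesh_gt0// ltr_nat.
by apply/eqP; rewrite eqn_leq (le1 _ _ jl kr) (le1 _ _ kl jr).
Qed.

Lemma cell_cover m N (x : Rd) :
  (forall i, - m%:R < tnth x i <= m%:R) -> exists j, cell m N j x.
Proof.
move=> xm.
have ex i : exists k : 'I_(m * 2 * (N + d).+1),
    k%:R * mesh N - m%:R < tnth x i <= k.+1%:R * mesh N - m%:R.
  have /andP[xl xr] := xm i.
  have xL : tnth x i <= (m * 2 * (N + d).+1)%:R * mesh N - m%:R.
    rewrite !natrM /mesh mulfK ?pnatr_eq0//; lra.
  (* The least grid point not below the coordinate is the right end of the wanted interval; it is
     not the point of index 0, since the coordinate exceeds [-m]. *)
  case: (ex_minnP (ex_intro (fun n : nat => tnth x i <= n%:R * mesh N - m%:R)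
    _ xL)) => -[|k] kx kmin; first by lra.
  have kL : (k < m * 2 * (N + d).+1)%N by exact: kmin.
  exists (Ordinal kL); rewrite kx andbT ltNge /=.
  by apply/negP => /kmin; rewrite ltnn.
have [j jx] := choice ex.
by exists [ffun i => j i]; apply/cellE => i; rewrite ffunE.
Qed.

Lemma cell_norm m N j (x : Rd) : cell m N j x ->
  forall i, - m%:R < tnth x i <= m%:R.
Proof.
move=> /cellE jx i; have /andP[xl xr] := jx i; apply/andP; split.
  by apply: le_lt_trans xl; rewrite lerDr mulr_ge0// ltW// mesh_gt0.
apply: (le_trans xr).
have : (j i).+1%:R * mesh N <= (m * 2 * (N + d).+1)%:R * mesh N.
  by rewrite ler_pM2r ?mesh_gt0// ler_nat.
rewrite !natrM {2}/mesh mulfK ?pnatr_eq0//; lra.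
Qed.

Lemma cell_sub_eball m N j (x : Rd) : cell m N j x ->
  cell m N j `<=` eball x (d.+1%:R * mesh N).
Proof.
move=> /cellE jx y /cellE jy; apply: lt_edist; first exact: mesh_gt0.
move=> i; have /andP[xl xr] := jx i; have /andP[yl yr] := jy i.
rewrite -natr1 mulrDl mul1r in xr yr.
rewrite ler_norml; apply/andP; split; lra.
Qed.

Variable mu : {measure set Rd -> \bar R}.
Hypothesis mu_leb : is_lebesgue mu.

Lemma lebesgue_cell m N j : mu (cell m N j) = (mesh N ^+ d)%:E.
Proof.
rewrite [mu _]mu_leb => [|i].
  rewrite (eq_bigr (fun=> mesh N)) => [|i _]; last first.
    by rewrite !tnth_mktuple -natr1; ring.
  by rewrite prodr_const card_ord.
rewrite !tnth_mktuple lerD2r ler_pM2r ?mesh_gt0//.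
by rewrite ler_nat.
Qed.

Lemma cell_not_negligible m N j : ~ mu.-negligible (cell m N j).
Proof.
move=> /(measure_negligible (measurable_box _ _)) mu0.
have : mu (cell m N j) = 0%E by exact: mu0.
rewrite lebesgue_cell => /eqP; rewrite eqe.
by rewrite gt_eqF// exprn_gt0// mesh_gt0.
Qed.

Lemma eball_not_negligible (x : Rd) (e : R) : 0 < e ->
  ~ mu.-negligible (eball x e).
Proof.
move=> e0; set s := e / d.+1%:R.
have s0 : 0 < s by rewrite divr_gt0.
(* The box with upper corner [x] and side [s] lies in the ball and has measure [s ^+ d > 0]. *)
pose a := [tuple tnth x i - s | i < d].
have sub : box a x `<=` eball x e.
  move=> y axy; have -> : e = d.+1%:R * s.
    by rewrite mulrC divfK// pnatr_eq0.
  apply: lt_edist => // i; have := axy i; rewrite tnth_mktuple ler_norml.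
  by move=> /andP[yl yr]; apply/andP; split; lra.
move=> /(negligibleS sub)/(measure_negligible (measurable_box _ _)) mu0.
have : mu (box a x) = 0%E by exact: mu0.
rewrite [mu _]mu_leb => [|i]; last by rewrite tnth_mktuple gerBl ltW.
under eq_bigr => i _ do rewrite tnth_mktuple subKr.
rewrite prodr_const => /eqP; rewrite eqe.
by rewrite gt_eqF// exprn_gt0.
Qed.

(** The left side is the integral of a step function. At a point of a cell its value is the
    oscillation over that cell, which lies in the ball around the point; elsewhere it is 0. *)
Lemma sum_osc_cell_le (psi : {measure set Rd -> \bar R}) m N f :
  (\sum_j osc mu (cell m N j) f * psi (cell m N j) <=
   \int[psi]_x osc mu (eball x (d.+1%:R * mesh N)) f)%E.
Proof.
have oscj0 j : (0 <= osc mu (cell m N j) f)%E.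
  exact/osc_ge0/cell_not_negligible.
pose F (j : {ffun 'I_d -> 'I_(m * 2 * (N + d).+1)}) x :=
  (osc mu (cell m N j) f * (\1_(cell m N j) x)%:E)%E.
have F0 j x : (0 <= F j x)%E by rewrite mule_ge0// lee_fin.
have mF j : measurable_fun setT (F j).
  apply: emeasurable_funM => //; apply/measurable_EFinP.
  by apply: measurable_indic; exact: measurable_box.
have -> : (\sum_j osc mu (cell m N j) f * psi (cell m N j) =
           \int[psi]_x \sum_j F j x)%E.
  rewrite ge0_integral_sum//; apply: eq_bigr => j _.
  rewrite ge0_integralZl//.
  - by rewrite integral_indic ?setIT//; exact: measurable_box.
  - by apply/measurable_EFinP; apply: measurable_indic; exact: measurable_box.
apply: ge0_le_integral_nonmeasurable => x _; first exact: sume_ge0.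
have [[j jx]|Nj] := pselect (exists j, cell m N j x); last first.
  rewrite big1 => [|j _].
    by apply/osc_ge0/eball_not_negligible; rewrite mulr_gt0// mesh_gt0.
  by rewrite /F indicE memNset ?mule0// => jx; apply: Nj; exists j.
rewrite (bigD1 j)//= big1 => [|k /eqP kj].
  rewrite adde0 /F indicE mem_set// mule1.
  by apply: le_osc; apply: cell_sub_eball jx.
rewrite /F indicE memNset ?mule0// => kx.
have /trivIsetP /(_ k j I I) := trivIset_cell m N.
by move=> /(_ (introN eqP kj)) kj0; have : set0 x by rewrite -kj0.
Qed.

End Grid.

(** * Estimates for functions of bounded variation norm *)

(** Otherwise points of the cube with [p] tending to 0 have a subsequence converging to some [L],
    and continuity contradicts [p L > 0]. [L] may lie on an excluded face of the half-open cube, so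
    positivity is taken on the whole space. *)
Lemma positive_lower_bound (R : realType) (d : nat) (p : d.-tuple R -> R) :
  econtinuous p -> (forall x, 0 < p x) -> forall m : nat,
  exists2 c : R, 0 < c & forall x,
    (forall i, - m%:R < tnth x i <= m%:R) -> c <= p x.
Proof.
move=> cp p0 m; apply: contrapT => nc.
have ex n : exists x : d.-tuple R,
    (forall i, - m%:R < tnth x i <= m%:R) /\ p x < n.+1%:R^-1.
  apply: contrapT => nx; apply: nc; exists n.+1%:R^-1 => // x xm.
  by rewrite leNgt; apply/negP => xn; apply: nx; exists x.
have [x xP] := choice ex.
have [|phi [phi_lt phi_cvg]] :=
    bounded_family_cvg_subseq R 'I_d (fun i n => tnth (x n) i).
  move=> i; exists m%:R => n; have [/(_ i) /andP[xl xr] _] := xP n.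
  by rewrite ler_norml xr ltW.
have phi_ge n : (n <= phi n)%N.
  by elim: n => // n ih; apply: leq_ltn_trans ih (phi_lt _ _ _).
pose L := [tuple limn ((fun n => tnth (x n) i) \o phi) | i < d].
have [del del0 delP] := cp L (p L / 2) (divr_gt0 (p0 L) (ltr0n _ 2)).
have s0 : 0 < del / d.+1%:R by rewrite divr_gt0.
have nearL : \forall n \near \oo, forall i,
    `|tnth L i - tnth (x (phi n)) i| <= del / d.+1%:R.
  apply: filter_forall => i.
  by have /cvgrPdist_le/(_ _ s0) := phi_cvg i; rewrite tnth_mktuple.
have pL2 : 0 < p L / 2 by rewrite divr_gt0.
have nearI : \forall n \near \oo, n.+1%:R^-1 < p L / 2.
  exact: near_infty_natSinv_lt (PosNum pL2).
have [n [nL nI]] := filter_ex (filterI nearL nearI).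
have /delP : Defs.edist L (x (phi n)) < del.
  have := lt_edist R d _ _ _ s0 nL.
  by rewrite mulrC divfK// pnatr_eq0.
have [_ px] := xP (phi n).
have : (phi n).+1%:R^-1 <= n.+1%:R^-1 :> R.
  by rewrite lef_pV2 ?posrE ?ltr0n// ler_nat ltnS.
move=> h1; have pn := lt_trans (lt_le_trans px h1) nI.
rewrite ltr_norml => /andP[h2 _]; lra.
Qed.

(** * Growth of the weight rho_alpha *)

Section Weight.
Variables (R : realType) (d : nat) (alpha : R).
Hypothesis alpha0 : 0 < alpha.

Let alpha2 : 0 <= alpha / 2.
Proof. by rewrite divr_ge0 ?ltW. Qed.

Lemma sqnorm_ge0 (x : d.-tuple R) : 0 <= sqnorm x.
Proof. by apply: sumr_ge0 => i _; exact: sqr_ge0. Qed.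

Lemma rho_ge (r : R) (x : d.-tuple R) : 0 <= r -> r <= sqnorm x ->
  (1 + r) `^ (alpha / 2) <= rho alpha x.
Proof.
move=> r0 rx; apply: ge0_ler_powR => //.
- by rewrite nnegrE addr_ge0.
- by rewrite nnegrE addr_ge0// sqnorm_ge0.
- by rewrite lerD2l.
Qed.

Lemma rho_ge1 (x : d.-tuple R) : 1 <= rho alpha x.
Proof.
by have := rho_ge 0 x (lexx _) (sqnorm_ge0 x); rewrite addr0 powR1.
Qed.

Lemma measurable_rho : measurable_fun setT (@rho R d alpha).
Proof.
have mS : measurable_fun setT (@sqnorm R d).
  have := @measurable_sum _ _ R setT 'I_d (index_enum _)
    (fun i (x : d.-tuple R) => tnth x i ^+ 2).
  by apply=> i; exact: (measurable_funX 2 (measurable_tnth i)).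
apply: (measurableT_comp (measurable_powR _)).
exact: measurable_funD.
Qed.

(** Some coordinate has absolute value at least [m], so the squared norm is at least [m ^+ 2]. *)
Lemma rho_outside (m : nat) (x : d.-tuple R) :
  ~ (forall i, - m%:R < tnth x i <= m%:R) ->
  (1 + m%:R ^+ 2) `^ (alpha / 2) <= rho alpha x.
Proof.
move=> /existsNP[i /negP xi]; apply: rho_ge; first exact: sqr_ge0.
rewrite /sqnorm (bigD1 i)//=; apply: ler_wpDr.
  by apply: sumr_ge0 => k _; exact: sqr_ge0.
rewrite -[leRHS]real_normK ?num_real// ler_pXn2r ?nnegrE//.
by move: xi; rewrite negb_and -leNgt -ltNge ler_normr => /orP[h|h]; lra.
Qed.

Lemma ex_large_rho (A : R) : exists m : nat,
  A <= (1 + m%:R ^+ 2) `^ (alpha / 2).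
Proof.
(* [B] is chosen so that [B] to the power [alpha / 2] is [Num.max 1 A], where the maximum keeps the
   base nonnegative; any [m >= 1] above [B] has [B <= 1 + m ^+ 2]. *)
pose B := (Num.max 1 A) `^ (2 / alpha).
have B0 : 0 <= B by exact: powR_ge0.
exists (Num.truncn B).+1.
have BM : B <= 1 + (Num.truncn B).+1%:R ^+ 2.
  have Bm : B < (Num.truncn B).+1%:R by exact: truncnS_gt.
  have m1 : 1 <= (Num.truncn B).+1%:R :> R by rewrite ler1n.
  nra.
apply: (@le_trans _ _ (B `^ (alpha / 2))); last first.
  by apply: ge0_ler_powR => //; rewrite nnegrE// addr_ge0// sqr_ge0.
have a1 : 2 / alpha * (alpha / 2) = 1 by field; rewrite gt_eqF.
rewrite /B -powRrM a1 powRr1.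
  by rewrite le_max lexx orbT.
by rewrite le_max ler01.
Qed.

End Weight.

(** * Consequences of a BV norm at most [C] *)

Section Estimates.
Variables (R : realType) (d : nat) (alpha : R).
Variables (mu psi : {measure set (d.-tuple R) -> \bar R}).
Variables (psi' : d.-tuple R -> R) (C : R).
Hypothesis alpha0 : 0 < alpha.
Hypothesis mu_leb : is_lebesgue mu.
Hypothesis psiE :
  forall A, measurable A -> psi A = (\int[mu]_(x in A) (psi' x)%:E)%E.
Implicit Types f : d.-tuple R -> R.

Let BV f := (BVnorm mu psi alpha f <= C%:E)%E.

Lemma integral_osc_ge0 f (eps : R) : 0 < eps ->
  (0 <= \int[psi]_x osc mu (eball x eps) f)%E.
Proof.
move=> e0; apply: integral_ge0 => x _; apply: osc_ge0.
exact: eball_not_negligible.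
Qed.

Lemma L1norm_w_ge0 f : (0 <= L1norm_w mu alpha f)%E.
Proof.
apply: integral_ge0 => x _; rewrite lee_fin mulr_ge0//.
exact: le_trans ler01 (rho_ge1 _ _ _ alpha0 x).
Qed.

(** Both summands of the norm are nonnegative, the supremum by its member at radius 1, so each of
    them is at most [C]. *)
Lemma BVnorm_le f : BV f ->
  (L1norm_w mu alpha f <= C%:E)%E /\
  (forall eps, 0 < eps <= 1 ->
    (\int[psi]_x osc mu (eball x eps) f <= (C * eps)%:E)%E).
Proof.
rewrite /BV /BVnorm; set S := ereal_sup _ => fC.
have Sub (eps : R) : 0 < eps <= 1 ->
    ((eps^-1)%:E * \int[psi]_x osc mu (eball x eps) f <= S)%E.
  by move=> he; apply: ereal_sup_ubound; exists eps.
have S0 : (0 <= S)%E.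
  apply: le_trans (Sub 1 _); last by rewrite ltr01 lexx.
  by rewrite mule_ge0// ?lee_fin ?invr_ge0// integral_osc_ge0.
split; first by apply: le_trans fC; rewrite leeDl.
move=> eps /[dup] he /andP[e0 _].
have SC : (S <= C%:E)%E by apply: le_trans fC; rewrite leeDr// L1norm_w_ge0.
have := le_trans (Sub _ he) SC.
by rewrite muleC lee_pdivrMr.
Qed.

Lemma L1norm_le f : measurable_fun setT f -> BV f ->
  (\int[mu]_x (`|f x|)%:E <= C%:E)%E.
Proof.
move=> mf /BVnorm_le[fC _]; apply: le_trans fC.
apply: ge0_le_integral_nonmeasurable => x _; rewrite lee_fin//.
by rewrite ler_peMl// rho_ge1.
Qed.

Lemma BV_integrable f : measurable_fun setT f -> BV f ->
  mu.-integrable setT (EFin \o f).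
Proof.
move=> mf fC; apply/integrableP; split; first exact/measurable_EFinP.
exact: le_lt_trans (L1norm_le _ mf fC) (ltry _).
Qed.

(** * Approximation by step functions on a cube where [psi'] is at least [c] *)

Variables (m : nat) (c : R).
Hypothesis c0 : 0 < c.
Hypothesis cP : forall x, (forall i, - m%:R < tnth x i <= m%:R) -> c <= psi' x.

Let cell := cell R d m.
Let mesh := mesh R d.
Let o N f j := fine (osc mu (cell N j) f).
Let v N f j := fine (ess_inf_on mu (cell N j) f).

Let mcell N j : measurable (cell N j).
Proof. exact: measurable_box. Qed.

Let mu_cell N j : mu (cell N j) = (mesh N ^+ d)%:E.
Proof. exact: lebesgue_cell. Qed.

Let mesh0 N : 0 < mesh N.
Proof. exact: mesh_gt0. Qed.

Let osc0 N f j : (0 <= osc mu (cell N j) f)%E.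
Proof. by apply: osc_ge0; exact: cell_not_negligible. Qed.

Lemma psi_cell_ge N j : ((c * mesh N ^+ d)%:E <= psi (cell N j))%E.
Proof.
rewrite psiE// EFinM -(mu_cell N j) -integral_cst//.
apply: ge0_le_integral_nonmeasurable => x jx; rewrite lee_fin ?(ltW c0)//.
by apply: cP; exact: cell_norm jx.
Qed.

(** Taken from the BV seminorm at radius [d.+1 * mesh N], with [psi] of each cell replaced by its
    lower bound [k]. As [k > 0], one infinite oscillation would make the sum infinite. *)
Lemma sum_osc_le N f : BV f ->
  (forall j, (osc mu (cell N j) f < +oo)%E) /\
  \sum_j o N f j * (c * mesh N ^+ d) <= C * (d.+1%:R * mesh N).
Proof.
move=> /BVnorm_le[_ fC].
set k := c * mesh N ^+ d.
have k0 : 0 < k by rewrite mulr_gt0// exprn_gt0.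
have le_sum : (\sum_j osc mu (cell N j) f * k%:E <=
    (C * (d.+1%:R * mesh N))%:E)%E.
  apply: le_trans (fC _ _); last first.
    rewrite mulr_gt0//=.
    by rewrite ler_pdivrMr ?ltr0n// mul1r ler_nat ltnS leq_addl.
  apply: le_trans (sum_osc_cell_le R d mu mu_leb psi m N f).
  by apply: lee_sum => j _; apply: lee_wpmul2l => //; exact: psi_cell_ge.
have fin j : (osc mu (cell N j) f < +oo)%E.
  rewrite ltey; apply/negP => /eqP oy; move: le_sum.
  rewrite (bigD1 j)//= oy gt0_mulye ?lte_fin// addye ?leye_eq//.
  rewrite gt_eqF// (@lt_le_trans _ _ 0%E)// ?ltNy0//.
  by apply: sume_ge0 => i _; rewrite mule_ge0// lee_fin ltW.
split=> //; rewrite -lee_fin -sumEFin; apply: le_trans le_sum.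
apply: lee_sum => j _; rewrite EFinM fineK//.
by rewrite ge0_fin_numE.
Qed.

Lemma osc_fine_ge0 N f j : 0 <= o N f j.
Proof. exact: fine_ge0. Qed.

Lemma ae_cell_bounds N f j : BV f ->
  \forall x \ae mu, cell N j x -> v N f j <= f x <= v N f j + o N f j.
Proof.
move=> /(sum_osc_le N)[fin _]; apply: ae_osc_bounds => //.
exact: cell_not_negligible.
Qed.

(** Triangle inequality through the heights [v N f1 j] and [v N f2 j], each within the oscillation
    of its function almost everywhere on the cell. *)
Lemma integral_cell_dist_le N f1 f2 j :
  measurable_fun setT f1 -> measurable_fun setT f2 -> BV f1 -> BV f2 ->
  (\int[mu]_(x in cell N j) (`|f1 x - f2 x|)%:E <=
   ((o N f1 j + o N f2 j + `|v N f1 j - v N f2 j|) * mesh N ^+ d)%:E)%E.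
Proof.
move=> mf1 mf2 BV1 BV2; rewrite EFinM -(mu_cell N j) -integral_cst//.
have o1 := osc_fine_ge0 N f1 j; have o2 := osc_fine_ge0 N f2 j.
apply: ae_ge0_le_integral => //.
- apply/measurable_EFinP; apply: measurableT_comp => //.
  by apply: measurable_funTS; exact: measurable_funB.
- by move=> x _; rewrite lee_fin !addr_ge0.
have := ae_cell_bounds N f2 j BV2; have := ae_cell_bounds N f1 j BV1.
apply: filterS2 => x b1 b2 jx; rewrite lee_fin.
have /andP[l1 r1] := b1 jx; have /andP[l2 r2] := b2 jx.
have := ler_norm (v N f1 j - v N f2 j).
have := ler_norm (v N f2 j - v N f1 j); rewrite distrC => n2 n1.
rewrite ler_norml; apply/andP; split; lra.
Qed.

(** Supplies the bound, uniform in [f], for the extraction of a subsequence: [|v| <= |f| + o] almost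
    everywhere on the cell, integrated over it. *)
Lemma ess_inf_cell_bounded N f j : measurable_fun setT f -> BV f ->
  `|v N f j| * mesh N ^+ d <= C + C * (d.+1%:R * mesh N) / c.
Proof.
move=> mf BVf; have [_ sumo] := sum_osc_le N f BVf.
have oj : o N f j * mesh N ^+ d <= C * (d.+1%:R * mesh N) / c.
  rewrite ler_pdivlMr// -mulrA [_ * c]mulrC; apply: le_trans sumo.
  rewrite (bigD1 j)//= lerDl; apply: sumr_ge0 => i _.
  by rewrite mulr_ge0 ?osc_fine_ge0// mulr_ge0 ?ltW// exprn_gt0.
suff : `|v N f j| * mesh N ^+ d <= C + o N f j * mesh N ^+ d by lra.
rewrite -lee_fin EFinD !EFinM -!(mu_cell N j).
rewrite -!integral_cst//.
have o1 := osc_fine_ge0 N f j.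
have mfE : measurable_fun (cell N j) (fun x => (`|f x|)%:E).
  apply/measurable_EFinP; apply: measurableT_comp => //.
  exact: measurable_funTS.
have fC : (\int[mu]_(x in cell N j) (`|f x|)%:E <= C%:E)%E.
  apply: le_trans (L1norm_le f mf BVf).
  apply: ge0_subset_integral => //.
  by apply/measurable_EFinP; apply: measurableT_comp.
apply: le_trans (leeD fC (lexx _)).
rewrite -ge0_integralD//.
apply: ae_ge0_le_integral => //.
- by move=> x _; rewrite lee_fin.
- by move=> x _; rewrite -EFinD lee_fin addr_ge0.
- exact: emeasurable_funD.
have := ae_cell_bounds N f j BVf; apply: filterS => x b1 jx.
rewrite -EFinD lee_fin; have /andP[l1 r1] := b1 jx.
have := ler_norm (f x); have := ler_norm (- f x); rewrite normrN => n2 n1.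
rewrite ler_norml; apply/andP; split; lra.
Qed.

(** The three terms are the mass outside the cube, where the weight is at least [r], the
    oscillations of both functions inside the cells, and the distance of the two step functions. *)
Lemma dist_L1_le N f1 f2 (r : R) :
  measurable_fun setT f1 -> measurable_fun setT f2 -> BV f1 -> BV f2 ->
  0 < r ->
  (forall x : d.-tuple R,
    ~ (forall i, - m%:R < tnth x i <= m%:R) -> r <= rho alpha x) ->
  (\int[mu]_x (`|f1 x - f2 x|)%:E <=
   (2 * C / r + 2 * (C * (d.+1%:R * mesh N) / c) +
    \sum_j `|v N f1 j - v N f2 j| * mesh N ^+ d)%:E)%E.
Proof.
move=> mf1 mf2 BV1 BV2 r0 rP.
pose Q := \big[setU/set0]_j cell N j.
have mQ : measurable Q by apply: bigsetU_measurable => j _; exact: mcell.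
have mE : measurable_fun setT (fun x => (`|f1 x - f2 x|)%:E).
  by apply/measurable_EFinP; apply: measurableT_comp => //; exact: measurable_funB.
rewrite -(setUv Q) ge0_integral_setU//; last 3 first.
- exact: measurableC.
- by rewrite setUv.
- by rewrite disj_set2E setICr.
rewrite -[X in (_ <= X%:E)%E]addrA [X in (_ <= X%:E)%E]addrC EFinD.
apply: leeD.
  rewrite /Q ge0_integral_bigsetU//; last 3 first.
  - exact: index_enum_uniq.
  - apply: sub_trivIset (trivIset_cell R d m N); exact: subsetT.
  - exact: measurable_funTS.
  apply: (@le_trans _ _ (\sum_j ((o N f1 j + o N f2 j +
      `|v N f1 j - v N f2 j|) * mesh N ^+ d)%:E)%E).
    by apply: lee_sum => j _; exact: integral_cell_dist_le.
  rewrite sumEFin lee_fin.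
  under eq_bigr => j _ do rewrite mulrDl mulrDl.
  rewrite big_split/= lerD2r big_split/= mulrDl mul1r.
  have [_ s1] := sum_osc_le N f1 BV1; have [_ s2] := sum_osc_le N f2 BV2.
  by apply: lerD; rewrite ler_pdivlMr// mulr_suml;
    under eq_bigr => j _ do rewrite -mulrA [_ * c]mulrC.
have Qout x : (~` Q) x -> ~ (forall i, - m%:R < tnth x i <= m%:R).
  move=> Qx xm; apply: Qx; have [j jx] := cell_cover R d m N x xm.
  by rewrite /Q (bigD1 j)//=; left.
have rho0 (x : d.-tuple R) : 0 <= rho alpha x.
  exact: le_trans ler01 (rho_ge1 _ _ _ alpha0 x).
have mrho f : measurable_fun setT f ->
    measurable_fun setT (fun x : d.-tuple R => (rho alpha x * `|f x|)%:E).
  move=> mf; apply/measurable_EFinP; apply: measurable_funM.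
    exact: measurable_rho.
  exact: measurableT_comp.
(* Outside the cube [1 <= rho / r]; the domain is then enlarged to the whole space to reach the two
   weighted norms. *)
apply: (@le_trans _ _ (\int[mu]_(x in ~` Q) ((r^-1)%:E *
    ((rho alpha x * `|f1 x|)%:E + (rho alpha x * `|f2 x|)%:E)))%E).
  apply: ge0_le_integral_nonmeasurable => x Qx; rewrite lee_fin//.
  rewrite -mulrDr [leRHS]mulrC ler_pdivlMr// mulrC.
  apply: (@le_trans _ _ (r * (`|f1 x| + `|f2 x|))).
    by rewrite ler_pM2l// ler_normB.
  by apply: ler_wpM2r; [rewrite addr_ge0|exact/rP/Qout].
have h0 (x : d.-tuple R) : (0 <= (rho alpha x * `|f1 x|)%:E +
    (rho alpha x * `|f2 x|)%:E)%E.
  by rewrite -EFinD lee_fin addr_ge0// mulr_ge0.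
have mh : measurable_fun setT (fun x : d.-tuple R => (rho alpha x * `|f1 x|)%:E +
    (rho alpha x * `|f2 x|)%:E)%E.
  by apply: emeasurable_funD; exact: mrho.
apply: le_trans (ge0_subset_integral mu _ measurableT _ _ (@subsetT _ _)) _.
- exact: measurableC.
- by apply: emeasurable_funM.
- by move=> x _; rewrite mule_ge0// lee_fin invr_ge0 ltW.
rewrite ge0_integralZl_EFin//; last by rewrite invr_ge0 ltW.
rewrite ge0_integralD//; last 4 first.
- by move=> x _; rewrite lee_fin mulr_ge0.
- exact: mrho.
- by move=> x _; rewrite lee_fin mulr_ge0.
- exact: mrho.
have [C1 _] := BVnorm_le _ BV1; have [C2 _] := BVnorm_le _ BV2.
have -> : 2 * C / r = r^-1 * (C + C) by ring.
rewrite EFinM EFinD; apply: lee_wpmul2l; first by rewrite lee_fin invr_ge0 ltW.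
exact: leeD.
Qed.

End Estimates.

(** * Extraction of the convergent subsequence *)

Lemma ex_mesh_le (R : realType) (d : nat) (e : R) : 0 < e ->
  exists N, mesh R d N <= e.
Proof.
move=> e0; have [N _ /(_ N (leqnn N)) /= Ne] :=
  near_infty_natSinv_lt (PosNum e0).
exists N; apply: le_trans (ltW Ne).
by rewrite /mesh lef_pV2 ?posrE ?ltr0n// ler_nat ltnS leq_addr.
Qed.

Theorem theorem16 (R : realType) (d : nat) (alpha : R)
  (mu : {measure set (d.-tuple R) -> \bar R})
  (psi : {measure set (d.-tuple R) -> \bar R}) (psi' : d.-tuple R -> R)
  (g : nat -> d.-tuple R -> R) :
  0 < alpha ->
  is_lebesgue mu ->
  econtinuous psi' ->
  (exists M : R, forall x, `|psi' x| <= M) ->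
  (forall x, 0 < psi' x) ->
  (forall A, measurable A -> psi A = (\int[mu]_(x in A) (psi' x)%:E)%E) ->
  psi setT = 1%E ->
  (forall n, measurable_fun setT (g n)) ->
  (exists C : R, forall n, (BVnorm mu psi alpha (g n) <= C%:E)%E) ->
  exists (phi : nat -> nat) (h : d.-tuple R -> R),
    {homo phi : m n / (m < n)%N >-> (m < n)%N} /\
    measurable_fun setT h /\ mu.-integrable setT (EFin \o h) /\
    (fun k => (\int[mu]_x (`|g (phi k) x - h x|)%:E)%E) @ \oo --> 0%E.
Proof.
move=> alpha0 mu_leb psi'_cont _ psi'_gt0 psiE _ mg [C gC].
have C0 : 0 <= C.
  rewrite -lee_fin; have [gn _] := BVnorm_le _ _ _ _ _ _ alpha0 mu_leb _ (gC 0%N).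
  by apply: le_trans gn; exact: L1norm_w_ge0.
(* One index for each cell of each grid of each cube: a countable family, so one [phi] serves every
   [m] and [N]. *)
pose I : countType := {p : nat * nat &
  {ffun 'I_d -> 'I_(p.1 * 2 * (p.2 + d).+1)}}.
pose u (i : I) n := let: existT p j := i in
  fine (ess_inf_on mu (cell R d p.1 p.2 j) (g n)).
have [|phi [phi_lt phi_cvg]] := bounded_family_cvg_subseq R I u.
  move=> [[m N] j].
  have [c c0 cP] := positive_lower_bound R d psi' psi'_cont psi'_gt0 m.
  exists ((C + C * (d.+1%:R * mesh R d N) / c) / mesh R d N ^+ d) => n.
  rewrite ler_pdivlMr ?exprn_gt0 ?mesh_gt0//.
  exact: (ess_inf_cell_bounded _ _ _ _ _ _ _ alpha0 mu_leb psiE _ _ c0 cP _ _ _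
    (mg n) (gC n)).
have [h [mh ih hcvg]] : exists h : d.-tuple R -> R, [/\ measurable_fun setT h,
    mu.-integrable setT (EFin \o h) &
    (fun n => (\int[mu]_x (`|g (phi n) x - h x|)%:E)%E) @ \oo --> 0%E].
  apply: L1_complete => [n|e e0].
    exact: (BV_integrable _ _ _ _ _ _ alpha0 mu_leb _ (mg _) (gC _)).
  (* Order of choice: [m] from [e], then [c] from [m], the mesh from [c], and [n0] from the mesh,
     each error term taking [e / 3]. The summand 1 makes [r] positive. *)
  have [m mP] := ex_large_rho _ _ alpha0 (1 + 2 * C / (e / 3)).
  set r := (1 + m%:R ^+ 2) `^ (alpha / 2) in mP.
  have e3 : 0 < e / 3 by rewrite divr_gt0.
  have r0 : 0 < r.
    by apply: lt_le_trans mP; rewrite ltr_pwDl// divr_ge0 ?mulr_ge0// ltW.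
  have rC : 2 * C / r <= e / 3.
    rewrite ler_pdivrMr// [leRHS]mulrC -ler_pdivrMr//.
    by apply: le_trans mP; rewrite lerDr.
  have [c c0 cP] := positive_lower_bound R d psi' psi'_cont psi'_gt0 m.
  (* The summand 1 keeps [K] positive when [C = 0]. *)
  pose K := 2 * C * d.+1%:R / c + 1.
  have K0 : 0 < K by rewrite ltr_wpDl// divr_ge0 ?mulr_ge0// ltW.
  have [N NP] := ex_mesh_le R d (e / 3 / K) (divr_gt0 e3 K0).
  have NC : 2 * (C * (d.+1%:R * mesh R d N) / c) <= e / 3.
    rewrite ler_pdivlMr// in NP; apply: le_trans NP.
    rewrite /K mulrDr mulr1.
    have -> : 2 * (C * (d.+1%:R * mesh R d N) / c) =
      mesh R d N * (2 * C * d.+1%:R / c) by ring.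
    by rewrite lerDl ltW// mesh_gt0.
  pose J := {ffun 'I_d -> 'I_(m * 2 * (N + d).+1)}.
  pose l (j : J) := limn (u (existT _ (m, N) j) \o phi).
  (* The factor 2 pays for the triangle inequality through [l j]; the successor keeps [k] positive
     when there are no cells. *)
  pose k : R := 2 * (#|{: J}|.+1)%:R * mesh R d N ^+ d.
  have k0 : 0 < k by rewrite !mulr_gt0// exprn_gt0// mesh_gt0.
  (* A single grid has finitely many cells, so the convergence is uniform over them. *)
  have [n0 _ n0P] : \forall n \near \oo, forall j : J,
      `|l j - u (existT _ (m, N) j) (phi n)| <= e / 3 / k.
    apply: filter_forall => j.
    by have /cvgrPdist_le/(_ _ (divr_gt0 e3 k0)) := phi_cvg (existT _ (m, N) j).
  exists n0 => p q n0p n0q.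
  apply: le_trans (dist_L1_le _ _ _ _ _ _ _ alpha0 mu_leb psiE _ _ c0 cP N _ _ r
    (mg _) (mg _) (gC _) (gC _) r0 _) _.
    by move=> x; exact: rho_outside.
  rewrite lee_fin.
  suff sume : \sum_(j : J) `|u (existT _ (m, N) j) (phi p) -
      u (existT _ (m, N) j) (phi q)| * mesh R d N ^+ d <= e / 3.
    by have := lerD (lerD rC NC) sume; rewrite -!mulrDl -!mulr2n; lra.
  apply: (@le_trans _ _ (\sum_(j : J) (2 * (e / 3 / k)) * mesh R d N ^+ d)).
    apply: ler_sum => j _; apply: ler_wpM2r; first by rewrite exprn_ge0// ltW// mesh_gt0.
    have hp := n0P p n0p j; have hq := n0P q n0q j.
    apply: le_trans (ler_distD (l j) _ _) _; rewrite distrC in hp; lra.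
  rewrite sumr_const -[leLHS]mulr_natl.
  apply: (@le_trans _ _ (#|{: J}|.+1%:R * (2 * (e / 3 / k) * mesh R d N ^+ d))).
    apply: ler_wpM2r; last by rewrite ler_nat.
    by rewrite !mulr_ge0 ?invr_ge0 ?exprn_ge0// ltW// mesh_gt0.
  have -> : #|{: J}|.+1%:R * (2 * (e / 3 / k) * mesh R d N ^+ d) =
    k * (e / 3 / k) by rewrite /k; ring.
  by rewrite mulrC divfK// gt_eqF.
by exists phi, h.
Qed.
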